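(* Given two tensor bundles $\mathcal V,\mathcal W$ (over $n$-dimensional manifolds), the differential order of an algebraic natural differential operation $D$ from $\mathcal V$ to $\mathcal W$ is $O(\deg D)$. That is, there is a constant $C$ depending only on $\mathcal V$ and $\mathcal W$ such that every algebraic natural differential operation $D$ from $\mathcal V$ to $\mathcal W$ has order at most $C\cdot\deg D$.
   Context: $\mathbb K=\mathbb R$ or $\mathbb C$; manifolds are smooth $\mathbb K$-manifolds (real smooth, resp. complex analytic) of dimension $n$. A tensor bundle $\mathcal V$ with typical fibre $V$ is the vector bundle associated with the (co)frame bundle by a finite-dimensional rational representation $V$ of $\mathrm{GL}_n=\mathrm{GL}_n(\mathbb K)$; it is thus naturally defined on every $n$-manifold. $\mathrm{GL}_n^{(k)}$ denotes the group of $k$-jets at $0$ of local diffeomorphisms of $\mathbb K^n$ fixing $0$. $V^{(k)}=\bigoplus_{l=0}^{k}\mathrm S^l(\mathbb K^{n})^*\otimes V$ is the space of $k$-jets at $0$ of $V$-valued functions on $\mathbb K^n$ (local sections of $\mathcal V$), with the $\mathrm{GL}_n^{(k+1)}$-action induced by the transformation of tensor fields under local diffeomorphisms fixing $0$; it is not the tensor product action. $\mathrm{GL}_n^{(k+1)}$ acts on $W$ through $\mathrm{GL}_n$. A differential operation $D$ of order $\le k$ from $\mathcal V$ to $\mathcal W$ is a map on sections induced by a morphism of bundles from the $k$-jet bundle of $\mathcal V$ to $\mathcal W$ ($D v(z)$ depends only on the $k$-jet of $v$ at $z$); its order is the minimal such $k$. It is natural if its fibre map $\delta:V^{(k)}\to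 W$, in local coordinates, does not depend on the point and is $\mathrm{GL}_n^{(k+1)}$-equivariant. It is algebraic if $\delta$ is a polynomial map, and then $\deg D$ is the degree of the polynomial map $\delta$. *)

(* Defs.v *)
From HB Require Import structures.
From mathcomp Require Export all_boot all_order all_algebra.
From mathcomp Require Export mpoly complex.
From mathcomp Require Export boolp reals.

Set Implicit Arguments.
Unset Strict Implicit.
Unset Printing Implicit Defensive.

Import GRing.Theory.
Local Open Scope ring_scope.

Inductive ground := ground_real | ground_complex.

Definition ground_field (R : realType) (g : ground) : fieldType :=
  match g with ground_real => R : fieldType | ground_complex => R[i] : fieldType end.

Section Defs.
Variable K : fieldType.

(* A regular function on GL_n is a polynomial in the n * n matrix entries and
   in one more variable, which stands for det^-1. *)
Definition regular_fun n := {mpoly K[n * n + 1]}.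

(* Value of a matrix of regular functions at an A-valued point: a matrix g
   over a commutative ring A over K (via f), and t standing for (\det g)^-1. *)
Definition regular_mx n d (A : comNzRingType) (f : {rmorphism K -> A})
    (P : 'M[regular_fun n]_d) (g : 'M[A]_n) (t : A) : 'M[A]_d :=
  map_mx (mmap f (row_mx (mxvec g) (t%:M : 'M[A]_1) 0)) P.

(* Rational representation of GL_n(K) on the column space K^d. *)
Record ratrep n d := RatRep {
  rr_mx : 'M[regular_fun n]_d;
  rr_at (g : 'M[K]_n) : 'M[K]_d := regular_mx idfun rr_mx g (\det g)^-1;
  rr_at1 : rr_at 1%:M = 1%:M;
  rr_atM : forall g h, g \in unitmx -> h \in unitmx ->
    rr_at (g *m h) = rr_at g *m rr_at h
}.

Definition jet_eq n k (p q : {mpoly K[n]}) :=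
  forall m : 'X_{1..n}, (mdeg m <= k)%N -> p@_m = q@_m.

(* An element of GL_n^(k): a k-jet at 0 of a local diffeomorphism of K^n fixing
   0, given by its Taylor polynomial [jd_map] of degree at most k, together with
   the Taylor polynomial [jd_inv] of the inverse local diffeomorphism. *)
Record jet_diffeo n k := JetDiffeo {
  jd_map : n.-tuple {mpoly K[n]};
  jd_inv : n.-tuple {mpoly K[n]};
  jd_map_size : forall i, (msize (tnth jd_map i) <= k.+1)%N;
  jd_inv_size : forall i, (msize (tnth jd_inv i) <= k.+1)%N;
  jd_map0 : forall i, (tnth jd_map i)@_0%MM = 0;
  jd_inv0 : forall i, (tnth jd_inv i)@_0%MM = 0;
  jd_mapK : forall i, jet_eq k (tnth jd_map i \mPo jd_inv) 'X_i;
  jd_invK : forall i, jet_eq k (tnth jd_inv i \mPo jd_map) 'X_i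
}.

Definition jacobian n (phi : n.-tuple {mpoly K[n]}) : 'M[{mpoly K[n]}]_n :=
  \matrix_(i, j) (tnth phi i)^`M(j).

Definition linear_part n k (phi : jet_diffeo n k) : 'M[K]_n :=
  map_mx (mcoeff 0%MM) (jacobian (jd_map phi)).

(* V^(k) for V = K^d: the family of Taylor coefficients in V, one for each
   monomial of degree at most k. *)
Definition jet n d k := {ffun 'X_{1..n < k.+1} -> 'cV[K]_d}.

Definition jet_poly n d k (v : jet n d k) : 'cV[{mpoly K[n]}]_d :=
  \col_a \sum_(m : 'X_{1..n < k.+1}) v m a 0 *: 'X_[bmnm m].

Definition jet_of_poly n d k (p : 'cV[{mpoly K[n]}]_d) : jet n d k :=
  [ffun m : 'X_{1..n < k.+1} => map_mx (mcoeff (bmnm m)) p].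

(* Action of GL_n^(k+1) on V^(k): the k-jet at 0 of the transformed field
     x |-> rho (dphi (phi^-1 x)) (v (phi^-1 x)).
   By the chain rule det (dphi (phi^-1 x))^-1 = det (d(phi^-1) x), and the
   (k+1)-jets of phi and phi^-1 determine both Jacobians up to degree k. *)
Definition jet_act n d k (V : ratrep n d) (phi : jet_diffeo n k.+1)
    (v : jet n d k) : jet n d k :=
  let psi := jd_inv phi in
  jet_of_poly k
    (regular_mx (@mpolyC n K) (rr_mx V)
       (map_mx (comp_mpoly psi) (jacobian (jd_map phi))) (\det (jacobian psi))
     *m map_mx (comp_mpoly psi) (jet_poly v)).

Definition jet_coord n d k := ('X_{1..n < k.+1} * 'I_d)%type.

(* A polynomial map V^(k) -> K^e, in the coordinates of V^(k). *)
Definition poly_map n d e k := 'cV[{mpoly K[#|{: jet_coord n d k}|]}]_e.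

Definition poly_map_at n d e k (delta : poly_map n d e k) (v : jet n d k) :
    'cV[K]_e :=
  map_mx (meval (fun i => let c := enum_val i in v c.1 c.2 0)) delta.

Definition poly_map_deg n d e k (delta : poly_map n d e k) : nat :=
  \max_(b < e) (msize (delta b 0%R)).-1.

(* An algebraic natural differential operation D between the tensor bundles of
   V and W. Its fibre map is the same at each point of each chart, so D is
   given by this map V^(k) -> W, for some k bounding the order. *)
Record natural_operation n d e (V : ratrep n d) (W : ratrep n e) := NatOp {
  op_bound : nat;
  fibre_map : poly_map n d e op_bound;
  fibre_mapJ : forall (phi : jet_diffeo n op_bound.+1) (v : jet n d op_bound),
    poly_map_at fibre_map (jet_act V phi v) =
      rr_at W (linear_part phi) *m poly_map_at fibre_map v
}.

Section Operation.
Variables (n d e : nat) (V : ratrep n d) (W : ratrep n e).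
Variable D : natural_operation V W.

(* The value of D depends only on the r-jet of the field. *)
Definition depends_on_jet (r : nat) : Prop :=
  forall u v : jet n d (op_bound D),
    (forall m : 'X_{1..n < (op_bound D).+1}, (mdeg m <= r)%N -> u m = v m) ->
    poly_map_at (fibre_map D) u = poly_map_at (fibre_map D) v.

Lemma depends_on_some_jet : exists r, `[< depends_on_jet r >].
Proof.
exists (op_bound D); apply/asboolP => u v uv; congr poly_map_at.
by apply/ffunP => m; apply: uv; rewrite -ltnS bmdeg.
Qed.

Definition diff_order : nat := ex_minn depends_on_some_jet.

Definition diff_degree : nat := poly_map_deg (fibre_map D).

End Operation.
End Defs.

(* Main.v *)
Require Import Defs.

(** Only the dilations x |-> x / mu are needed. They act on the degree-m Taylor
coefficients of a field by mu^m times a matrix of the representation, so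
equivariance reads
  delta (mu^|m| u_m)_m = rho_W (mu^-1) delta (rho_V (mu) u_m)_m.
The left-hand side is a polynomial in mu; the right-hand side is a Laurent
polynomial of degree at most B = n deg rho_W + deg delta * deg rho_V. If u and
v agree up to order B, the difference of the left-hand sides for u and v is
divisible by mu^(B+1) while its degree is at most B: it vanishes, and mu = 1
gives delta u = delta v. *)

Set Implicit Arguments.
Unset Strict Implicit.
Unset Printing Implicit Defensive.

Import GRing.Theory Num.Theory.
Local Open Scope ring_scope.

(** * Growth at infinity of Laurent polynomials in one variable *)

Section LaurentDegree.
Variable K : fieldType.

(* On nonzero arguments f is a Laurent polynomial of degree at most B; the order
   A of its pole at 0 is not bounded. *)
Definition laurent_deg_le (B : nat) (f : K -> K) : Prop :=
  exists A (q : {poly K}), (size q <= (A + B).+1)%N /\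
    forall x, x != 0 -> x ^+ A * f x = q.[x].

Lemma eq_laurent_deg_le B f g :
  (forall x, x != 0 -> f x = g x) -> laurent_deg_le B f -> laurent_deg_le B g.
Proof.
move=> fg [A [q [szq qE]]]; exists A, q; split=> // x x0.
by rewrite -fg // qE.
Qed.

Lemma laurent_deg_leW B C f :
  (B <= C)%N -> laurent_deg_le B f -> laurent_deg_le C f.
Proof.
move=> BC [A [q [szq qE]]]; exists A, q; split=> //.
by apply: leq_trans szq _; rewrite ltnS leq_add2l.
Qed.

Lemma laurent_deg_le_horner (p : {poly K}) B :
  (size p <= B.+1)%N -> laurent_deg_le B (horner p).
Proof. by move=> szp; exists 0%N, p; split=> // x _; rewrite mul1r. Qed.

Lemma laurent_deg_le_cst c : laurent_deg_le 0 (fun=> c).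
Proof.
apply: (@eq_laurent_deg_le 0 (horner c%:P)) => [x _|]; first by rewrite hornerC.
by apply: laurent_deg_le_horner; rewrite size_polyC; case: (c != 0).
Qed.

(** Negative powers cost nothing: the pole at 0 is absorbed by the unbounded exponent [A]. *)
Lemma laurent_deg_le_invX j : laurent_deg_le 0 (fun x => x^-1 ^+ j).
Proof.
exists j, 1; split=> [|x x0]; first by rewrite size_poly1.
by rewrite hornerC -exprMn divff // expr1n.
Qed.

Lemma laurent_deg_leD B f g :
  laurent_deg_le B f -> laurent_deg_le B g ->
  laurent_deg_le B (fun x => f x + g x).
Proof.
move=> [a [p [szp pE]]] [b [q [szq qE]]].
(* Common pole order [a + b]: each numerator is multiplied by the power of ['X] that it lacks. *)
exists (a + b)%N, ('X^b * p + 'X^a * q); split=> [|x x0].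
  have shift (c i : nat) (r : {poly K}) :
      (size r <= (i + B).+1)%N -> (size ('X^c * r)%R <= (i + c + B).+1)%N.
    move=> szr; apply: leq_trans (size_polyMleq _ _) _.
    by rewrite size_polyXn addSn /= addnAC addnC -addSn leq_add2r.
  apply: leq_trans (size_polyD _ _) _; rewrite geq_max shift //=.
  by rewrite [(a + b)%N]addnC shift.
rewrite !hornerE /= -pE // -qE // mulrDr !mulrA -!exprD.
by rewrite [(b + a)%N]addnC.
Qed.

Lemma laurent_deg_leM B C f g :
  laurent_deg_le B f -> laurent_deg_le C g ->
  laurent_deg_le (B + C) (fun x => f x * g x).
Proof.
move=> [a [p [szp pE]]] [b [q [szq qE]]].
exists (a + b)%N, (p * q); split=> [|x x0].
  apply: leq_trans (size_polyMleq _ _) _.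
  have := leq_add szp szq; rewrite addSn addnS addnACA.
  by case: (size p + size q)%N.
by rewrite hornerM -pE // -qE // exprD mulrACA.
Qed.

Lemma laurent_deg_le_sum I (r : seq I) (P : pred I) B (f : I -> K -> K) :
  (forall i, P i -> laurent_deg_le B (f i)) ->
  laurent_deg_le B (fun x => \sum_(i <- r | P i) f i x).
Proof.
move=> fB; elim: r => [|i r IHr].
  apply: (@eq_laurent_deg_le B (fun=> 0)) => [x _|]; first by rewrite big_nil.
  exact: laurent_deg_leW (laurent_deg_le_cst 0).
case Pi: (P i); last first.
  by apply: eq_laurent_deg_le IHr => x _; rewrite big_cons Pi.
apply: eq_laurent_deg_le (laurent_deg_leD (fB i Pi) IHr) => x _.
by rewrite big_cons Pi.
Qed.

Lemma laurent_deg_le_prod I (r : seq I) (B : I -> nat) (f : I -> K -> K) :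
  (forall i, laurent_deg_le (B i) (f i)) ->
  laurent_deg_le (\sum_(i <- r) B i) (fun x => \prod_(i <- r) f i x).
Proof.
move=> fB; elim: r => [|i r IHr].
  rewrite big_nil; apply: eq_laurent_deg_le (laurent_deg_le_cst 1) => x _.
  by rewrite big_nil.
rewrite big_cons; apply: eq_laurent_deg_le (laurent_deg_leM (fB i) IHr) => x _.
by rewrite big_cons.
Qed.

Lemma laurent_deg_leX B f j :
  laurent_deg_le B f -> laurent_deg_le (j * B) (fun x => f x ^+ j).
Proof.
move=> fB; elim: j => [|j IHj]; first exact: laurent_deg_le_cst.
rewrite mulSn; apply: eq_laurent_deg_le (laurent_deg_leM fB IHj) => x _.
by rewrite exprS.
Qed.

(** A monomial of [p] is a product of at most [(msize p).-1] factors, each of degree at most [B]. *)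
Lemma laurent_deg_le_meval N (p : {mpoly K[N]}) B (f : 'I_N -> K -> K) :
  (forall i, laurent_deg_le B (f i)) ->
  laurent_deg_le ((msize p).-1 * B) (fun x => p.@[f^~ x]).
Proof.
(* The guard [m \in msupp p] keeps the membership that later yields [mdeg m < msize p]. *)
move=> fB; apply: (@eq_laurent_deg_le _ (fun x =>
    \sum_(m <- msupp p | m \in msupp p) p@_m * \prod_i f i x ^+ m i)) => [x _|].
  by rewrite mevalE [RHS]big_seq.
apply: laurent_deg_le_sum => m mp; rewrite -[(_ * B)%N]add0n.
apply: laurent_deg_leM (laurent_deg_le_cst _) _.
apply: laurent_deg_leW (laurent_deg_le_prod _ _); last first.
  by move=> i; apply: laurent_deg_leX (fB i).
rewrite -big_distrl /= -mdegE leq_mul2r.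
have := msize_mdeg_lt mp; case: (msize p) => //= s; rewrite ltnS => ->.
by rewrite orbT.
Qed.

Hypothesis charK : [pchar K] =i pred0.

(** In characteristic 0 the images of 1, ..., [size p] are distinct and nonzero, which gives more
    roots than the degree allows. *)
Lemma poly_eq0_on_units (p : {poly K}) :
  (forall x, x != 0 -> p.[x] = 0) -> p = 0.
Proof.
move=> p0; pose rs : seq K := [seq i.+1%:R | i <- iota 0 (size p)].
apply: (@roots_geq_poly_eq0 _ _ rs); last by rewrite size_map size_iota.
  apply/allP => _ /mapP[i _ ->]; apply/eqP/p0.
  by rewrite (proj1 (pcharf0P K) charK).
rewrite map_inj_uniq ?iota_uniq // => i j /eqP ij.
wlog leij : i j ij / (i <= j)%N => [W|].
  by case: (leqP i j) => [|/ltnW] h; [exact: W|apply/esym/W => //; rewrite eq_sym].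
move: ij; rewrite eq_sym -subr_eq0 -natrB // subSS (proj1 (pcharf0P K) charK).
by rewrite subn_eq0 => ji; apply/eqP; rewrite eqn_leq leij.
Qed.

(** The identity [x ^+ A * p.[x] = q.[x]] at nonzero points is an identity of polynomials, so sizes
    can be compared and the shift by [A] cancels. *)
Lemma laurent_deg_le_size (p : {poly K}) B :
  laurent_deg_le B (horner p) -> (size p <= B.+1)%N.
Proof.
move=> [A [q [szq qE]]]; have [->|p0] := eqVneq p 0; first by rewrite size_poly0.
have Ep: 'X^A * p = q.
  apply/eqP; rewrite -subr_eq0; apply/eqP/poly_eq0_on_units => x x0.
  by rewrite !hornerE qE // subrr.
by move: szq; rewrite -Ep size_monicM ?monicXn // size_polyXn addSn /= -addnS leq_add2l.
Qed.

End LaurentDegree.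

(** * Dilations and their action on jets *)

Section Dilation.
Variables (K : fieldType) (n : nat).

Definition dilation (x : K) : n.-tuple {mpoly K[n]} := [tuple x *: 'X_i | i < n].

Lemma msize_dilation x k i : (msize (tnth (dilation x) i) <= k.+2)%N.
Proof.
rewrite tnth_mktuple; have [->|x0] := eqVneq x 0; first by rewrite scale0r msize0.
by apply: leq_trans (msizeZ_le _ _) _; rewrite msizeX mdeg1.
Qed.

Lemma dilation0 x i : (tnth (dilation x) i)@_0%MM = 0.
Proof. by rewrite tnth_mktuple mcoeffZ mcoeffX mnm1_eq0 mulr0. Qed.

Lemma dilationK x y k i : y * x = 1 ->
  jet_eq k (tnth (dilation y) i \mPo dilation x) 'X_i.
Proof.
move=> xy m _; rewrite tnth_mktuple comp_mpolyZ comp_mpolyXU -tnth_nth.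
by rewrite tnth_mktuple scalerA xy scale1r.
Qed.

(** The dilation by [x] is taken as the inverse: the action precomposes fields with [jd_inv], so
    Taylor coefficients acquire nonnegative powers of [x]. *)
Definition dilation_jet (x : K) (x0 : x != 0) k : jet_diffeo K n k.+1 :=
  @JetDiffeo K n k.+1 (dilation x^-1) (dilation x)
    (msize_dilation x^-1 k) (msize_dilation x k) (dilation0 x^-1) (dilation0 x)
    (fun i => dilationK (k := k.+1) i (mulVf x0))
    (fun i => dilationK (k := k.+1) i (mulfV x0)).

Lemma jacobian_dilation x : jacobian (dilation x) = (x%:MP)%:M.
Proof.
apply/matrixP => i j; rewrite !mxE tnth_mktuple mderivZ mderivX.
rewrite mnm1E -mul_mpolyC; have [->|ij] := eqVneq i j.
  have -> : (U_(j) - U_(j) = 0)%MM by apply/mnmP => l; rewrite mnmBE subnn mnm0E.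
  by rewrite mulr1n scale1r mpolyX0 mulr1.
by rewrite mulr0n scale0r mulr0.
Qed.

Lemma linear_part_dilation x (x0 : x != 0) k :
  linear_part (dilation_jet x0 k) = x^-1%:M.
Proof.
rewrite /linear_part jacobian_dilation map_scalar_mx /=.
by congr (_%:M); rewrite mcoeffC eqxx mulr1.
Qed.

Lemma mmap_mpolyC N (f : 'I_N -> K) (p : {mpoly K[N]}) (h : 'I_N -> {mpoly K[n]}) :
  (forall i, h i = (f i)%:MP) -> mmap (@mpolyC n K) h p = (p.@[f])%:MP.
Proof.
move=> hE; rewrite mevalE raddf_sum /=; apply: eq_bigr => m _.
rewrite mpolyCM; congr (_ * _); rewrite rmorph_prod; apply: eq_bigr => i _.
by rewrite hE rmorphXn.
Qed.

Lemma mcoeff_comp_dilation x (p : {mpoly K[n]}) m :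
  (p \mPo dilation x)@_m = x ^+ mdeg m * p@_m.
Proof.
rewrite comp_mpolyEX [in RHS](mpolyE p) !raddf_sum /= mulr_sumr.
apply: eq_bigr => m' _; rewrite !mcoeffZ mcoeffX comp_mpolyX.
under eq_bigr do rewrite tnth_mktuple exprZn.
rewrite scaler_prod prodrXr -mdegE -mpolyXE_id mcoeffZ mcoeffX.
by have [->|] := eqVneq m' m; rewrite ?mulr1 ?mulr0 // mulrC.
Qed.

Lemma mcoeff_jet_poly d k (v : jet K n d k) a (m : 'X_{1..n < k.+1}) :
  (jet_poly v a 0)@_m = v m a 0.
Proof.
rewrite mxE raddf_sum /= (bigD1 m) //= big1 => [|m' m'm].
  by rewrite addr0 mcoeffZ mcoeffX eqxx mulr1.
by rewrite mcoeffZ mcoeffX (inj_eq val_inj) (negbTE m'm) mulr0.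
Qed.

(** The Jacobian of a dilation is constant, so the representation contributes a constant matrix and
    does not mix Taylor coefficients of different orders. *)
Lemma jet_act_dilation d k (V : ratrep K n d) x (x0 : x != 0) (v : jet K n d k) :
  jet_act V (dilation_jet x0 k) v =
  [ffun m : 'X_{1..n < k.+1} => x ^+ mdeg m *: (rr_at V x^-1%:M *m v m)].
Proof.
rewrite /jet_act /= !jacobian_dilation map_scalar_mx det_scalar.
have -> : regular_mx (@mpolyC n K) (rr_mx V)
    ((x^-1%:MP \mPo dilation x)%:M) (x%:MP ^+ n) =
    map_mx (@mpolyC n K) (rr_at V x^-1%:M).
  apply/matrixP => a b; rewrite !mxE; apply: mmap_mpolyC => i.
  rewrite comp_mpolyC -rmorphXn /= !mxE.
  (* The last variable stands for the inverse determinant: [x ^+ n] is the inverse of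
     [\det (x^-1%:M)]. *)
  case: splitP => j _; last by rewrite ord1 !mxE eqxx det_scalar exprVn invrK.
  case/mxvec_indexP: j => a' b'; rewrite !mxvecE !mxE.
  by case: eqP => _; rewrite ?mulr0n ?mulr1n // mpolyC0.
apply/ffunP => m; rewrite !ffunE; apply/colP => a; rewrite !mxE raddf_sum /=.
rewrite mulr_sumr; apply: eq_bigr => b _.
rewrite [map_mx _ _ a b]mxE [map_mx _ _ b 0]mxE mcoeffCM mcoeff_comp_dilation.
by rewrite mcoeff_jet_poly mulrCA.
Qed.

End Dilation.

(** * Multivariate polynomials evaluated at univariate ones *)

Section HornerMmap.
Variables (K : fieldType) (N : nat).
Implicit Types (p : {mpoly K[N]}) (h : 'I_N -> {poly K}).

Lemma horner_mmap_polyC p h x :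
  (mmap polyC h p).[x] = p.@[fun i => (h i).[x]].
Proof.
rewrite mevalE horner_sum; apply: eq_bigr => m _; rewrite hornerM hornerC.
congr (_ * _); rewrite horner_prod; apply: eq_bigr => i _.
by rewrite horner_exp.
Qed.

(** Congruence modulo [q] is preserved by sums and products, hence by polynomial expressions. *)
Lemma dvdp_mmap_polyC_sub (q : {poly K}) p h h' :
  (forall i, q %| h i - h' i) -> q %| mmap polyC h p - mmap polyC h' p.
Proof.
move=> qh; rewrite -sumrB; apply: (big_ind (dvdp q)) => [|a b|m _]; first exact: dvdp0.
  exact: dvdp_add.
rewrite -mulrBr dvdp_mull // /mmap1.
apply: (big_ind2 (fun a b => q %| a - b)) => [|a a' b b' qa qb|i _].
- by rewrite subrr dvdp0.
- have -> : a * b - a' * b' = (a - a') * b + a' * (b - b').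
    by rewrite mulrBl mulrBr addrA subrK.
  by apply: dvdp_add; [exact: dvdp_mulr | exact: dvdp_mull].
by rewrite subrXX dvdp_mulr.
Qed.

End HornerMmap.

(** * From equivariance under dilations to the bound on the order *)

Lemma rr_at_scalarK (K : fieldType) n d (V : ratrep K n d) (x : K) :
  x != 0 -> rr_at V x^-1%:M *m rr_at V x%:M = 1%:M.
Proof.
move=> x0; rewrite -rr_atM ?unitmxE ?det_scalar ?unitrX ?unitfE ?invr_eq0 //.
by rewrite -scalar_mxM mulVf // rr_at1.
Qed.

Section Order.
Variables (K : fieldType) (n d e : nat) (V : ratrep K n d) (W : ratrep K n e).
Hypothesis charK : [pchar K] =i pred0.

(** The degree is taken in all [n * n + 1] variables, the one for the inverse determinant counting
    as degree one. *)
Definition ratrep_deg m (U : ratrep K n m) : nat :=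
  \max_(a < m) \max_(b < m) (msize (rr_mx U a b)).-1.

Lemma msize_ratrep m (U : ratrep K n m) a b :
  ((msize (rr_mx U a b)).-1 <= ratrep_deg U)%N.
Proof.
apply: leq_trans (leq_bigmax (F := fun a => \max_(b < m) _) a).
exact: (leq_bigmax (F := fun b => (msize (rr_mx U a b)).-1)).
Qed.

(** At a scalar matrix the variables take only the values [s x], 0 and the inverse determinant
    [(s x)^-1 ^+ n]; the two hypotheses bound the nonzero ones. *)
Lemma laurent_deg_le_rr_at m (U : ratrep K n m) B (s : K -> K) a b :
  laurent_deg_le B s -> laurent_deg_le B (fun x => (s x)^-1 ^+ n) ->
  laurent_deg_le (ratrep_deg U * B) (fun x => rr_at U (s x)%:M a b).
Proof.
move=> sB tB; apply: laurent_deg_leW (leq_mul (msize_ratrep U a b) (leqnn B)) _.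
pose f i x : K := row_mx (mxvec ((s x)%:M : 'M_n)) ((s x)^-1 ^+ n)%:M 0 i.
apply: (@eq_laurent_deg_le _ _ (fun x => (rr_mx U a b).@[f^~ x])) => [x _|].
  rewrite [RHS]mxE; apply: meval_eq => i.
  by rewrite /f det_scalar exprVn.
apply: laurent_deg_le_meval => i.
case: (split_ordP i) => j ->; last first.
  apply: eq_laurent_deg_le tB => x _.
  by rewrite /f row_mxEr ord1 mxE eqxx.
case/mxvec_indexP: j => a' b'.
have [ab'|ab'] := eqVneq a' b'.
  apply: eq_laurent_deg_le sB => x _.
  by rewrite /f row_mxEl mxvecE mxE ab' eqxx.
apply: laurent_deg_leW (leq0n B) _.
apply: eq_laurent_deg_le (laurent_deg_le_cst 0) => x _.
by rewrite /f row_mxEl mxvecE mxE (negbTE ab').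
Qed.

Variable D : natural_operation V W.
Let k := op_bound D.

(** Equivariance is applied to the jet premultiplied by [rr_at V x%:M], which cancels the matrix
    [rr_at V x^-1%:M] of the action. *)
Lemma poly_map_at_dilation (v : jet K n d k) x : x != 0 ->
  poly_map_at (fibre_map D) [ffun m : 'X_{1..n < k.+1} => x ^+ mdeg m *: v m] =
  rr_at W x^-1%:M *m
    poly_map_at (fibre_map D) [ffun m : 'X_{1..n < k.+1} => rr_at V x%:M *m v m].
Proof.
move=> x0; rewrite -(linear_part_dilation n x0 k) -fibre_mapJ jet_act_dilation.
congr poly_map_at; apply/ffunP => m; rewrite !ffunE mulmxA rr_at_scalarK //.
by rewrite mul1mx.
Qed.

(** Component [b] of the fibre map on the dilated jet, with the dilation factor as an
    indeterminate. *)
Definition dilation_poly (v : jet K n d k) (b : 'I_e) : {poly K} :=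
  mmap polyC (fun i => let c := enum_val i in v c.1 c.2 0 *: 'X^(mdeg c.1))
    (fibre_map D b 0%R).

Lemma horner_dilation_poly v b x : (dilation_poly v b).[x] =
  poly_map_at (fibre_map D) [ffun m : 'X_{1..n < k.+1} => x ^+ mdeg m *: v m] b 0.
Proof.
rewrite horner_mmap_polyC mxE; apply: meval_eq => i /=.
by rewrite ffunE mxE hornerZ hornerXn mulrC.
Qed.

Lemma size_dilation_poly v b :
  (size (dilation_poly v b) <=
    (n * ratrep_deg W + diff_degree D * ratrep_deg V).+1)%N.
Proof.
apply: laurent_deg_le_size => //.
apply: (@eq_laurent_deg_le _ _ (fun x => \sum_c rr_at W x^-1%:M b c *
   poly_map_at (fibre_map D) [ffun m : 'X_{1..n < k.+1} => rr_at V x%:M *m v m] c 0)) => [x x0|].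
  by rewrite horner_dilation_poly poly_map_at_dilation // mxE.
apply: laurent_deg_le_sum => c _; apply: laurent_deg_leM.
  (* For [s x = x^-1] the inverse determinant is [x ^+ n], whence the factor [n]. *)
  rewrite mulnC; apply: laurent_deg_le_rr_at.
    exact: laurent_deg_leW (leq0n n) (laurent_deg_le_invX K 1).
  apply: (@eq_laurent_deg_le _ _ (horner 'X^n)) => [x _|].
    by rewrite invrK hornerXn.
  by apply: laurent_deg_le_horner; rewrite size_polyXn.
have deg_c : ((msize (fibre_map D c 0%R)).-1 <= diff_degree D)%N.
  exact: (leq_bigmax (F := fun c => (msize (fibre_map D c 0%R)).-1)).
apply: laurent_deg_leW (leq_mul deg_c (leqnn _)) _.
apply: (@eq_laurent_deg_le _ _ (fun x => (fibre_map D c 0%R).@[fun i =>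
   let c := enum_val i in \sum_a rr_at V x%:M c.2 a * v c.1 a 0])) => [x _|].
  by rewrite [RHS]mxE; apply: meval_eq => i /=; rewrite ffunE mxE.
apply: laurent_deg_le_meval => i /=; apply: laurent_deg_le_sum => a _.
rewrite -[X in laurent_deg_le X]addn0.
apply: laurent_deg_leM (laurent_deg_le_cst _).
(* For [s x = x] the inverse determinant is a negative power, so [B = 1] suffices. *)
rewrite -[ratrep_deg V]muln1; apply: laurent_deg_le_rr_at.
  apply: (@eq_laurent_deg_le _ _ (horner 'X)) => [x _|]; first by rewrite hornerX.
  by apply: laurent_deg_le_horner; rewrite size_polyX.
exact: laurent_deg_leW (leq0n 1) (laurent_deg_le_invX K n).
Qed.

Lemma depends_on_jet_degree :
  depends_on_jet D (n * ratrep_deg W + diff_degree D * ratrep_deg V).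
Proof.
set r := (_ + _)%N; move=> u v uv; apply/colP => b.
suff uvE : dilation_poly u b = dilation_poly v b.
  have at1 w : poly_map_at (fibre_map D) w b 0 = (dilation_poly w b).[1].
    rewrite horner_dilation_poly; congr (poly_map_at _ _ _ _).
    by apply/ffunP => m; rewrite ffunE expr1n scale1r.
  by rewrite !at1 uvE.
apply/eqP; rewrite -subr_eq0; apply/negPn/negP => uv0.
(* Coordinates of order at most [r] agree and all others carry a factor ['X^(r.+1)]; a nonzero
   difference would then have degree above [r]. *)
have /dvdp_leq-/(_ uv0) : 'X^(r.+1) %| dilation_poly u b - dilation_poly v b.
  apply: dvdp_mmap_polyC_sub => i /=; set c := enum_val i.
  rewrite -scalerBl; have [le_cr|lt_rc] := leqP (mdeg c.1) r.
    by rewrite uv // subrr scale0r dvdp0.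
  by rewrite -mul_polyC dvdp_mull // dvdp_exp2l.
rewrite size_polyXn leqNgt ltnS => /negP[].
by rewrite (leq_trans (size_polyD _ _)) // size_polyN geq_max !size_dilation_poly.
Qed.

(** In degree 0 the term [n * ratrep_deg W] cannot be absorbed into a multiple of the degree, but
    the fibre map is then constant. *)
Lemma depends_on_jet_cst : diff_degree D = 0%N -> depends_on_jet D 0.
Proof.
move=> deg0 u v _; apply/colP => b; rewrite !mxE.
have /msize1_polyC-> : (msize (fibre_map D b 0%R) <= 1)%N.
  have := leq_bigmax (F := fun b => (msize (fibre_map D b 0%R)).-1) b.
  by rewrite -[X in (_ <= X)%N]/(diff_degree D) deg0; case: (msize _) => [|[]].
by rewrite !mevalC.
Qed.

Lemma diff_order_le :
  (diff_order D <= (n * ratrep_deg W + ratrep_deg V) * diff_degree D)%N.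
Proof.
rewrite /diff_order; case: ex_minnP => o _ o_min; apply: o_min; apply/asboolP.
have [deg0|deg_gt0] := posnP (diff_degree D).
  by rewrite deg0 muln0; apply: depends_on_jet_cst.
move=> u v uv; apply: depends_on_jet_degree => m m_le; apply: uv.
(* Positivity of the degree lets it multiply the term [n * ratrep_deg W] as well. *)
apply: leq_trans m_le _; rewrite mulnDl mulnC leq_add //.
  by rewrite leq_pmulr.
by rewrite mulnC.
Qed.

End Order.

Theorem theorem2 (R : realType) (g : ground) (n d e : nat)
    (V : ratrep (ground_field R g) n d) (W : ratrep (ground_field R g) n e) :
  exists C : nat, forall D : natural_operation V W,
    (diff_order D <= C * diff_degree D)%N.
Proof.
exists (n * ratrep_deg W + ratrep_deg V)%N => D; apply: diff_order_le.
(* Both ground fields are numeric, hence of characteristic 0. *)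
by case: (g); apply: pchar_num.
Qed.
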